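(* For any graphs $G$ and $H$, $$\mathrm{DOM}(G\,\square\, H)\ \ge\ \max\{\mathrm{DOM}(G)\,\alpha(H),\ \alpha(G)\,\mathrm{DOM}(H)\}$$ and $$\mathrm{DOM}(G\,\square\, H)\ \le\ \min\{\mathrm{DOM}(G)\,n(H),\ n(G)\,\mathrm{DOM}(H)\}.$$ Moreover, the bounds are sharp, i.e., there exist graphs $G$ and $H$ for which the first inequality holds with equality, and there exist graphs $G$ and $H$ for which the second inequality holds with equality.
   Context: Graphs are finite, simple and undirected (with at least one vertex); $n(G)$ denotes the order of $G$ and $\alpha(G)$ its independence number. An orientation of $G$ is a digraph obtained by directing every edge of $G$ in exactly one of its two possible directions. In a digraph $D$ with vertex set $V(D)$ and arc set $A(D)$, a vertex $u$ dominates $v$ if $(u,v)\in A(D)$; a set $S\subseteq V(D)$ is a dominating set if every vertex of $V(D)\setminus S$ is dominated by some vertex of $S$; $\gamma(D)$ is the smallest cardinality of a dominating set of $D$. The orientable domination number of a graph $G$ is $\mathrm{DOM}(G)=\max\{\gamma(D): D \text{ is an orientation of } G\}$. The Cartesian product $G\,\square\, H$ has vertex set $V(G)\times V(H)$, and $(u,v)$, $(x,y)$ are adjacent if either $u=x$ and $vy\in E(H)$, or $v=y$ and $ux\in E(G)$. *)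

(* Defs.v *)
From mathcomp Require Import all_boot.

Set Implicit Arguments.
Unset Strict Implicit.
Unset Printing Implicit Defensive.

Record sgraph := SGraph {
  vertex :> finType;
  adj : rel vertex;
  adj_sym : symmetric adj;
  adj_irr : irreflexive adj;
  vertex_gt0 : 0 < #|vertex|
}.

Definition stable (G : sgraph) (S : {set G}) : bool :=
  [forall u in S, forall v in S, ~~ adj u v].

Definition indep_num (G : sgraph) : nat := \max_(S : {set G} | stable S) #|S|.

(* A digraph on T is given by its set of arcs; (u, v) is the arc from u to v. *)
Definition dominating (T : finType) (D : {set T * T}) (S : {set T}) : bool :=
  [forall v in ~: S, exists u in S, (u, v) \in D].

Lemma dominating_setT (T : finType) (D : {set T * T}) : dominating D setT.
Proof. by apply/forall_inP => v; rewrite !inE. Qed.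

Definition domination_num (T : finType) (D : {set T * T}) : nat :=
  #|[arg min_(S < [set: T] | dominating D S) #|S| ]|.

Definition orientation (G : sgraph) (D : {set G * G}) : bool :=
  [forall u, forall v,
     if adj u v then ((u, v) \in D) (+) ((v, u) \in D) else (u, v) \notin D].

(* So the maximum in DOM is never taken over an empty family. *)
Lemma orientation_exists (G : sgraph) : exists D : {set G * G}, orientation D.
Proof.
exists [set p | adj p.1 p.2 & enum_rank p.1 < enum_rank p.2].
apply/forallP => u; apply/forallP => v; rewrite !inE /= (adj_sym v u).
case: (boolP (adj u v)) => //= uv.
case: ltngtP => // /ord_inj/enum_rank_inj eq_uv.
by rewrite eq_uv adj_irr in uv.
Qed.

Definition DOM (G : sgraph) : nat :=
  \max_(D : {set G * G} | orientation D) domination_num D.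

Section CartesianProduct.
Variables G H : sgraph.

Definition cart_adj : rel (G * H)%type :=
  fun p q => ((p.1 == q.1) && adj p.2 q.2) || ((p.2 == q.2) && adj p.1 q.1).

Lemma cart_adj_sym : symmetric cart_adj.
Proof.
by move=> p q; rewrite /cart_adj (eq_sym p.1) (eq_sym p.2)
  (adj_sym p.1) (adj_sym p.2).
Qed.

Lemma cart_adj_irr : irreflexive cart_adj.
Proof. by move=> p; rewrite /cart_adj !adj_irr !andbF. Qed.

Lemma cart_gt0 : 0 < #|{: G * H}|.
Proof. by rewrite card_prod muln_gt0 !vertex_gt0. Qed.

Definition cart_prod : sgraph := SGraph cart_adj_sym cart_adj_irr cart_gt0.

End CartesianProduct.

(* Main.v *)
Require Import Defs.
From mathcomp Require Import all_boot.

(** In the product of [G] and [H], the fibre of [h : H] is the copy of [G]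
    formed by the pairs [(g, h)].

    Upper bound: an orientation of the product induces an orientation of every
    fibre, and the union of minimum dominating sets of these is dominating in
    the product; so [#|H|] sets of size at most [DOM G] suffice
    ([DOM_cart_prod_le]).

    Lower bound: take an optimal orientation of [G], and orient [H] so that no
    arc enters a maximum stable set [S]; this is possible because [S] spans no
    edge ([source_orientation]). In the product of these two orientations, a
    vertex in the fibre of some [h] in [S] can only be dominated from inside
    that fibre. A dominating set therefore meets each of these [#|S|] disjoint
    fibres in at least [DOM G] vertices ([DOM_cart_prod_ge]).

    The two remaining inequalities follow by exchanging the factors.

    Sharpness: when [H] is edgeless, its independence number is its order, so
    [DOM G * indep_num H] and [DOM G * #|H|] coincide and all the bounds that
    lie between them are equal. The one-vertex graph is such an [H]. *)

Set Implicit Arguments.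
Unset Strict Implicit.
Unset Printing Implicit Defensive.

(** * Domination in digraphs and orientations *)

Definition min_dominating (T : finType) (D : {set T * T}) : {set T} :=
  [arg min_(S < [set: T] | dominating D S) #|S| ].

Lemma min_dominatingP (T : finType) (D : {set T * T}) :
  dominating D (min_dominating D).
Proof. by rewrite /min_dominating; case: arg_minnP => //; exact: dominating_setT. Qed.

Lemma domination_num_min (T : finType) (D : {set T * T}) S :
  dominating D S -> domination_num D <= #|S|.
Proof.
rewrite /domination_num; case: arg_minnP => [|S0 _ minS0]; last exact: minS0.
exact: dominating_setT.
Qed.

Lemma dominatingP (T : finType) (D : {set T * T}) (S : {set T}) :
  reflect (forall v, v \notin S -> exists2 u, u \in S & (u, v) \in D)
          (dominating D S).
Proof.
apply: (iffP forall_inP) => [domS v vS | domS v].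
  by apply/exists_inP/domS; rewrite inE.
by rewrite inE => vS; apply/exists_inP/domS.
Qed.

Lemma orientationP (G : sgraph) (D : {set G * G}) :
  reflect (forall u v, if adj u v then ((u, v) \in D) (+) ((v, u) \in D)
                       else (u, v) \notin D)
          (orientation D).
Proof.
apply: (iffP forallP) => oD u; first by move=> v; exact: (forallP (oD u)).
by apply/forallP => v; exact: oD.
Qed.

Lemma orientation_loopless (G : sgraph) (D : {set G * G}) u :
  orientation D -> (u, u) \in D = false.
Proof. by move=> /orientationP/(_ u u); rewrite adj_irr => /negPf. Qed.

Lemma domination_num_le_DOM (G : sgraph) (D : {set G * G}) :
  orientation D -> domination_num D <= DOM G.
Proof. by move=> oD; rewrite /DOM (bigmax_sup D). Qed.

Lemma DOM_attained (G : sgraph) :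
  exists2 D : {set G * G}, orientation D & domination_num D = DOM G.
Proof.
have: 0 < #|[pred D : {set G * G} | orientation D]|.
  by case: (orientation_exists G) => D oD; apply/card_gt0P; exists D.
by case/(eq_bigmax_cond (fun D => domination_num D)) => D oD DOM_D; exists D.
Qed.

(** With [f] a fibre inclusion this restricts a digraph to the fibre; with [f]
    an isomorphism it transports a digraph backwards. *)
Definition pullback (S T : finType) (f : S -> T) (D : {set T * T}) :
  {set S * S} := [set p | (f p.1, f p.2) \in D].

Lemma orientation_pullback (G K : sgraph) (f : G -> K) (D : {set K * K}) :
    (forall u v, adj (f u) (f v) = adj u v) ->
  orientation D -> orientation (pullback f D).
Proof.
move=> adj_f /orientationP oD; apply/orientationP => u v.
by have := oD (f u) (f v); rewrite adj_f !inE.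
Qed.

(** An optimal orientation of [G] pulls back along [f] to an orientation of
    [K], and [f] maps dominating sets of the pullback to dominating sets, since
    it is onto and sends arcs to arcs. *)
Lemma DOM_cover (G K : sgraph) (f : K -> G) (g : G -> K) :
    cancel g f -> (forall u v, adj (f u) (f v) = adj u v) ->
  DOM G <= DOM K.
Proof.
move=> gK adj_f; case: (DOM_attained G) => D oD <-.
apply: leq_trans (domination_num_le_DOM (orientation_pullback adj_f oD)).
apply: leq_trans (leq_imset_card f (mem (min_dominating (pullback f D)))).
apply/domination_num_min/dominatingP => v v_notin.
have /dominatingP/(_ (g v)) := min_dominatingP (pullback f D).
case=> [|u uS]; first by apply: contra v_notin => gvS; rewrite -[v]gK imset_f.
by rewrite inE /= gK => uv; exists (f u); rewrite ?imset_f.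
Qed.

Lemma DOM_cart_prodC (G H : sgraph) :
  DOM (cart_prod G H) = DOM (cart_prod H G).
Proof.
have swap_le (K L : sgraph) : DOM (cart_prod K L) <= DOM (cart_prod L K).
  pose swap (S T : sgraph) (p : cart_prod S T) : cart_prod T S := (p.2, p.1).
  apply: (@DOM_cover _ _ (swap L K) (swap K L)) => [[] //|u v].
  by rewrite /= /cart_adj /= orbC.
by apply/eqP; rewrite eqn_leq !swap_le.
Qed.

Lemma card_fibres (S T : finType) (A : {set S * T}) :
  #|A| = \sum_(y : T) #|[set x | (x, y) \in A]|.
Proof.
rewrite -sum1_card (partition_big snd xpredT) //=; apply: eq_bigr => y _.
rewrite sum1_card -[RHS](card_imset _ (f := fun x => (x, y))); last by move=> ? ? [].
apply: eq_card => -[x z]; rewrite unfold_in /=.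
apply/andP/imsetP => [[xzA /eqP <-]|[x']]; first by exists x; rewrite ?inE.
by rewrite inE => x'yA [-> ->].
Qed.

(** * The upper bound *)

Lemma DOM_cart_prod_le (G H : sgraph) :
  DOM (cart_prod G H) <= DOM G * #|H|.
Proof.
apply/bigmax_leqP => D oD.
pose fibre (h : H) (g : G) : cart_prod G H := (g, h).
have adj_fibre h u v : adj (fibre h u) (fibre h v) = adj u v.
  by rewrite /= /cart_adj /= adj_irr andbF eqxx.
pose S h := min_dominating (pullback (fibre h) D).
pose U : {set cart_prod G H} := [set p | p.1 \in S p.2].
have domU : dominating D U.
  apply/dominatingP => -[g h]; rewrite inE /= => gS.
  have /dominatingP/(_ g gS)[u uS] := min_dominatingP (pullback (fibre h) D).
  by rewrite inE => ug; exists (u, h); rewrite ?inE.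
apply: leq_trans (domination_num_min domU) _.
rewrite card_fibres mulnC -sum_nat_const; apply: leq_sum => h _.
rewrite (_ : [set _ | _] = S h); last by apply/setP=> g; rewrite !inE.
exact: domination_num_le_DOM (orientation_pullback (adj_fibre h) oD).
Qed.

(** * The lower bound *)

Definition digraph_prod (S T : finType) (D : {set S * S}) (E : {set T * T}) :
  {set (S * T) * (S * T)} :=
  [set a | (a.1.1 == a.2.1) && ((a.1.2, a.2.2) \in E)
        || (a.1.2 == a.2.2) && ((a.1.1, a.2.1) \in D)].

Lemma orientation_digraph_prod (G H : sgraph)
    (D : {set G * G}) (E : {set H * H}) :
  orientation D -> orientation E ->
  @orientation (cart_prod G H) (digraph_prod D E).
Proof.
move=> oD oE; apply/orientationP => -[g h] [g' h'].
rewrite !inE /= /cart_adj /= (eq_sym g' g) (eq_sym h' h).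
have [<-|_] := eqVneq g g'; have [<-|_] := eqVneq h h' => //=.
- by rewrite !adj_irr !orientation_loopless.
- by rewrite !orbF; exact: (orientationP _ oE).
- exact: (orientationP _ oD).
Qed.

(** No edge joins two vertices of [S], so every edge that meets [S] can be
    directed out of [S]; the other edges follow an arbitrary orientation. *)
Lemma source_orientation (H : sgraph) (S : {set H}) : stable S ->
  exists2 E : {set H * H}, orientation E &
    forall u v, v \in S -> (u, v) \notin E.
Proof.
move=> stS; have nadj (u v : H) : u \in S -> v \in S -> adj u v = false.
  move=> uS vS.
  by move/forall_inP: stS => /(_ u uS)/forall_inP/(_ v vS)/negPf.
case: (orientation_exists H) => E0 /orientationP oE0.
exists [set p | adj p.1 p.2 &
          (p.1 \in S) || (p.2 \notin S) && (p \in E0)].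
  apply/orientationP => u v; rewrite !inE /= (adj_sym v u).
  have := oE0 u v; case: ifP => //= uv.
  case: (boolP (u \in S)) => uS; case: (boolP (v \in S)) => vS //=.
  by rewrite nadj in uv.
move=> u v vS; rewrite inE /= vS orbF.
by apply/andP => -[uv uS]; rewrite nadj in uv.
Qed.

Lemma max_stable_attained (H : sgraph) :
  exists2 S : {set H}, stable S & #|S| = indep_num H.
Proof.
have: 0 < #|[pred S : {set H} | stable S]|.
  apply/card_gt0P; exists set0.
  by apply/forall_inP => u; rewrite inE.
by case/(eq_bigmax_cond (fun S : {set H} => #|S|)) => S stS indepS; exists S.
Qed.

Lemma DOM_cart_prod_ge (G H : sgraph) :
  DOM G * indep_num H <= DOM (cart_prod G H).
Proof.
case: (DOM_attained G) => D oD <-.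
case: (max_stable_attained H) => S stS <-.
case: (source_orientation stS) => E oE sourceS.
apply: leq_trans (domination_num_le_DOM (orientation_digraph_prod oD oE)).
rewrite [leqRHS]/domination_num -/(min_dominating _).
set U := min_dominating (digraph_prod D E).
have /dominatingP domU : dominating (digraph_prod D E) U.
  exact: min_dominatingP.
rewrite card_fibres mulnC -sum_nat_const [leqRHS](bigID (mem S)) /=.
apply: leq_trans (leq_addr _ _); apply: leq_sum => h hS.
apply/domination_num_min/dominatingP => g; rewrite inE => ghU.
(* Nothing enters [h] in [E], so a dominator of [(g, h)] lies over [h]. *)
case: (domU (g, h) ghU) => -[g' h'] g'U.
rewrite inE /= (negPf (sourceS h' h hS)) andbF /= => /andP[/eqP eq_h g'g].
by exists g'; rewrite ?inE -?eq_h.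
Qed.

(** * Both bounds together, and their sharpness *)

Lemma DOM_cart_prod_bounds (G H : sgraph) :
  maxn (DOM G * indep_num H) (indep_num G * DOM H) <= DOM (cart_prod G H)
  /\ DOM (cart_prod G H) <= minn (DOM G * #|H|) (#|G| * DOM H).
Proof.
rewrite geq_max leq_min DOM_cart_prod_ge DOM_cart_prod_le /=.
rewrite DOM_cart_prodC (mulnC (indep_num G)) (mulnC #|G|).
by rewrite DOM_cart_prod_ge DOM_cart_prod_le.
Qed.

(** The hypothesis makes the lower bound of [DOM_cart_prod_ge] equal to the
    upper bound of [DOM_cart_prod_le]; the maximum and the minimum are squeezed
    between them. *)
Lemma DOM_cart_prod_sharp (G H : sgraph) : indep_num H = #|H| ->
  DOM (cart_prod G H) = maxn (DOM G * indep_num H) (indep_num G * DOM H)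
  /\ DOM (cart_prod G H) = minn (DOM G * #|H|) (#|G| * DOM H).
Proof.
move=> edgelessH; have [ge_max le_min] := DOM_cart_prod_bounds G H.
have DOM_GH : DOM (cart_prod G H) = DOM G * #|H|.
  apply/eqP; rewrite eqn_leq DOM_cart_prod_le -edgelessH.
  exact: DOM_cart_prod_ge.
split; apply/eqP; rewrite eqn_leq ?ge_max ?le_min ?andbT /= DOM_GH.
  by rewrite edgelessH leq_maxl.
exact: geq_minl.
Qed.

Lemma unit_adj_sym : symmetric (fun _ _ : unit => false).
Proof. by []. Qed.

Lemma unit_adj_irr : irreflexive (fun _ : unit => xpred0 : pred unit).
Proof. by []. Qed.

Lemma unit_gt0 : 0 < #|{: unit}|.
Proof. by rewrite card_unit. Qed.

Definition one_vertex_graph : sgraph :=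
  SGraph unit_adj_sym unit_adj_irr unit_gt0.

Lemma indep_num_one_vertex : indep_num one_vertex_graph = #|one_vertex_graph|.
Proof.
apply/eqP; rewrite eqn_leq; apply/andP; split.
  by apply/bigmax_leqP => S _; exact: max_card.
rewrite -cardsT /indep_num (bigmax_sup [set: one_vertex_graph]) //.
by apply/forall_inP => u _; apply/forall_inP.
Qed.

Theorem theorem4p1 :
  (forall G H : sgraph,
     maxn (DOM G * indep_num H) (indep_num G * DOM H) <= DOM (cart_prod G H)
     /\ DOM (cart_prod G H) <= minn (DOM G * #|H|) (#|G| * DOM H))
  /\ (exists G H : sgraph,
        DOM (cart_prod G H)
        = maxn (DOM G * indep_num H) (indep_num G * DOM H))
  /\ (exists G H : sgraph,
        DOM (cart_prod G H) = minn (DOM G * #|H|) (#|G| * DOM H)).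
Proof.
have [max_sharp min_sharp] :=
  DOM_cart_prod_sharp one_vertex_graph indep_num_one_vertex.
split; first exact: DOM_cart_prod_bounds.
by split; exists one_vertex_graph, one_vertex_graph.
Qed.
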